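(* Let $q$ be a prime power, let $C\subseteq\mathbb{F}_q^n$ be an $\mathbb{F}_q$-linear code of length $n$, let $X_1,\dots,X_\ell$ be mutually disjoint sets with $[n]=X_1\sqcup\cdots\sqcup X_\ell$, let $T_i\subseteq X_i$ for $1\le i\le \ell$, and let $\chi$ be a non-trivial character of $\mathbb{F}_q$. Then $$\mathrm{SCJ}_{C^{\perp},X_1(T_1),\dots,X_\ell(T_\ell)}\big(\{\{x_{X_i,a},y_{X_i,a}\}_{a\in\mathbb{F}_q}\}_{1\le i\le\ell}\big)=\frac{1}{|C|}\,\mathrm{SCJ}_{C,X_1(T_1),\dots,X_\ell(T_\ell)}\left(\left\{\left\{\sum_{b\in\mathbb{F}_q}\chi(ab)\,x_{X_i,b},\ \sum_{b\in\mathbb{F}_q}\chi(ab)\,y_{X_i,b}\right\}_{a\in\mathbb{F}_q}\right\}_{1\le i\le\ell}\right),$$ i.e. the right-hand side is obtained by substituting $\sum_{b}\chi(ab)x_{X_i,b}$ for $x_{X_i,a}$ and $\sum_{b}\chi(ab)y_{X_i,b}$ for $y_{X_i,a}$.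
   Context: $[n]=\{1,\dots,n\}$. An $\mathbb{F}_q$-linear code of length $n$ is a vector subspace of $\mathbb{F}_q^n$. The inner product is $\mathbf{u}\cdot\mathbf{v}=u_1v_1+\cdots+u_nv_n$ and $C^\perp=\{\mathbf{v}\in\mathbb{F}_q^n\mid \mathbf{u}\cdot\mathbf{v}=0\text{ for all }\mathbf{u}\in C\}$. A character of $\mathbb{F}_q$ is a homomorphism from the additive group $\mathbb{F}_q$ to the multiplicative group $\mathbb{C}^\times$. For $X\subseteq[n]$, $a\in\mathbb{F}_q$, $\mathbf{u}\in\mathbb{F}_q^n$, put $n_{a,X}(\mathbf{u})=\#\{i\in X\mid u_i=a\}$. The split complete Jacobi polynomial of $C$ attached to $T_1,\dots,T_\ell$ (where $[n]=X_1\sqcup\cdots\sqcup X_\ell$ and $T_i\subseteq X_i$) is the polynomial, with complex coefficients in commuting variables $x_{X_i,a},y_{X_i,a}$ ($1\le i\le\ell$, $a\in\mathbb{F}_q$), $$\mathrm{SCJ}_{C,X_1(T_1),\dots,X_\ell(T_\ell)}\big(\{\{x_{X_i,a},y_{X_i,a}\}_{a}\}_{i}\big)=\sum_{\mathbf{u}\in C}\prod_{i=1}^{\ell}\prod_{a\in\mathbb{F}_q}x_{X_i,a}^{\,n_{a,T_i}(\mathbf{u})}\,y_{X_i,a}^{\,n_{a,X_i\setminus T_i}(\mathbf{u})}.$$ *)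

(* Defs.v *)
From HB Require Import structures.
From mathcomp Require Import all_boot all_order all_algebra.
From mathcomp Require Import reals complex mpoly.
Set Implicit Arguments.
Unset Strict Implicit.
Unset Printing Implicit Defensive.
Import Order.TTheory GRing.Theory Num.Theory.
Local Open Scope ring_scope.

Section Codes.
Variables (F : finFieldType) (n : nat).
Implicit Types (u v : 'rV[F]_n) (C : {vspace 'rV[F]_n}).

Definition inner u v : F^o := \sum_(i < n) u 0 i * v 0 i.

Definition dual_code C : {vspace 'rV[F]_n} :=
  (\bigcap_(u in C) lker (linfun (inner u)))%VS.

Fact inner_is_linear u : linear (inner u).
Proof.
move=> a v w; rewrite /inner scaler_sumr -big_split /=.
by apply: eq_bigr => i _; rewrite !mxE mulrDr mulrCA.
Qed.

(* [linfun] is only meaningful on linear functions; this lemma certifies that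
   [dual_code] is the orthogonal of C. *)
Lemma dual_codeP C v :
  reflect (forall u, u \in C -> inner u v = 0) (v \in dual_code C).
Proof.
have linE u : linfun (inner u) v = inner u v.
  pose f : {linear 'rV[F]_n -> F^o} :=
    HB.pack (inner u) (GRing.isLinear.Build _ _ _ _ (inner u) (inner_is_linear u)).
  exact: (lfunE f).
rewrite memvE; apply: (iffP subv_bigcapP) => h u uC.
  by move: (h u uC); rewrite -memvE memv_ker linE => /eqP.
by rewrite -memvE memv_ker linE h.
Qed.

Definition ncoord (a : F) (X : {set 'I_n}) u : nat := #|[set i in X | u 0 i == a]|.

End Codes.

Definition add_character (F : finFieldType) (R : realType) (chi : F -> R[i]) : Prop :=
  (forall a, chi a != 0) /\ {morph chi : a b / a + b >-> a * b}.

Definition nontrivial_character (F : finFieldType) (R : realType)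
    (chi : F -> R[i]) : Prop :=
  add_character chi /\ exists a, chi a != 1.

(* [inl (i, a)] indexes x_{X_i,a} and [inr (i, a)] indexes y_{X_i,a}. *)
Notation jvar l F := (('I_l * F) + ('I_l * F))%type.

Section Jacobi.
Variables (R : realType) (F : finFieldType) (n l : nat).

Definition jpoly := {mpoly R[i][#|{: jvar l F}|]}.

Definition xvar (i : 'I_l) (a : F) : jpoly := 'X_(enum_rank (inl (i, a) : jvar l F)).
Definition yvar (i : 'I_l) (a : F) : jpoly := 'X_(enum_rank (inr (i, a) : jvar l F)).

Definition SCJ (C : {vspace 'rV[F]_n}) (X T : 'I_l -> {set 'I_n}) : jpoly :=
  \sum_(u in C) \prod_(i < l) \prod_(a : F)
     (xvar i a ^+ ncoord a (T i) u * yvar i a ^+ ncoord a (X i :\: T i) u).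

(* p with fx i a substituted for x_{X_i,a} and fy i a for y_{X_i,a}. *)
Definition jsubst (p : jpoly) (fx fy : 'I_l -> F -> jpoly) : jpoly :=
  p \mPo [tuple match enum_val k with
                | inl ia => fx ia.1 ia.2
                | inr ia => fy ia.1 ia.2
                end | k < #|{: jvar l F}|].

End Jacobi.

(* Main.v *)
(** Grouping the factors of a monomial by coordinate instead of by letter turns
    the split complete Jacobi polynomial into a sum over [C] of products
    [\prod_k g k (u_k)], where [g k a] is [x_{X_i,a}] if [k \in T_i] and
    [y_{X_i,a}] if [k \in X_i \ T_i].  The identity is then Poisson summation:
    expanding [\prod_k \sum_b chi(u_k b) g k b] and summing over [C] first
    leaves the character sums [\sum_(u in C) chi(u . v)], which equal [|C|] or
    [0] according to whether [v] is in the dual code. *)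
Require Import Defs.
From HB Require Import structures.
From mathcomp Require Import all_boot all_order all_algebra.
From mathcomp Require Import reals complex mpoly.
Set Implicit Arguments.
Unset Strict Implicit.
Unset Printing Implicit Defensive.
Import Order.TTheory GRing.Theory Num.Theory.
Local Open Scope ring_scope.

Lemma innerDl (F : finFieldType) (n : nat) (u w v : 'rV[F]_n) :
  inner (u + w) v = inner u v + inner w v.
Proof.
by rewrite /inner -big_split; apply: eq_bigr => i _; rewrite !mxE mulrDl.
Qed.

Lemma innerZl (F : finFieldType) (n : nat) (c : F) (u v : 'rV[F]_n) :
  inner (c *: u) v = c * inner u v.
Proof.
by rewrite /inner mulr_sumr; apply: eq_bigr => i _; rewrite !mxE mulrA.
Qed.

Section CharacterSums.
Variables (K : fieldType) (F : finFieldType) (chi : F -> K).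
Hypothesis chiD : {morph chi : a b / a + b >-> a * b}.
Hypothesis chi0 : chi 0 = 1.
Hypothesis chi_neq1 : exists a, chi a != 1.

(** Closure of [C] under scalars is essential: the multiples of one word not orthogonal to [v] give
    [inner _ v] every value in [F], including one where [chi] is not 1. *)
Lemma sum_character_code (n : nat) (C : {vspace 'rV[F]_n}) (v : 'rV[F]_n) :
  \sum_(u in C) chi (inner u v) = if v \in dual_code C then #|C|%:R else 0.
Proof.
case: ifPn => [/dual_codeP v_dual | v_ndual].
  under eq_bigr => u uC do rewrite v_dual // chi0.
  by rewrite sumr_const.
have [u0 u0C u0v] : exists2 u, u \in C & inner u v != 0.
  apply/exists_inP; apply: contraNT v_ndual => /exists_inPn h.
  by apply/dual_codeP => u uC; apply/eqP; rewrite -[_ == _]negbK h.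
have [a chi_a] := chi_neq1.
(* Translating by [w], for which [chi (w . v) = chi a <> 1], multiplies the sum
   by [chi a] while only permuting its terms. *)
pose w := (a / inner u0 v) *: u0.
have wC : w \in C by rewrite memvZ.
have chi_w : chi (inner w v) = chi a by rewrite innerZl divfK.
set S := \sum_(u in C) _.
have S_chi : S = chi a * S.
  rewrite {1}/S (reindex_inj (addrI w)) /= mulr_sumr.
  by apply: eq_big => u; [rewrite rpredDl | rewrite innerDl chiD chi_w].
apply/eqP; have /eqP : (1 - chi a) * S = 0 by rewrite mulrBl mul1r -S_chi subrr.
by rewrite mulf_eq0 subr_eq0 eq_sym (negPf chi_a).
Qed.

Lemma character_sum (I : finType) (f : I -> F) :
  chi (\sum_i f i) = \prod_i chi (f i).
Proof. exact: (big_morph chi chiD chi0). Qed.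

Lemma poisson_summation_code (A : comAlgType K) (n : nat)
    (C : {vspace 'rV[F]_n}) (g : 'I_n -> F -> A) :
  \sum_(u in C) \prod_(k < n) \sum_b chi (u 0 k * b) *: g k b =
  #|C|%:R *: \sum_(v in dual_code C) \prod_(k < n) g k (v 0 k).
Proof.
under eq_bigr => u _.
  rewrite bigA_distr_bigA.
  (* The expansion runs over choice functions ['I_n -> F]; reading them as row vectors makes the
     product of the scalars equal to [chi (inner u v)]. *)
  rewrite (reindex (fun v : 'rV[F]_n => [ffun k => v 0 k])) /=; last first.
    exists (fun f : {ffun 'I_n -> F} => \row_k f k) => [v | f] _.
      by apply/rowP => k; rewrite mxE ffunE.
    by apply/ffunP => k; rewrite ffunE mxE.
  under eq_bigr => v _.
    under eq_bigr => k _ do rewrite ffunE.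
    rewrite scaler_prod -character_sum -/(inner u v).
    over.
  over.
rewrite exchange_big /= scaler_sumr [RHS]big_mkcond /=.
apply: eq_bigr => v _; rewrite -scaler_suml sum_character_code.
by case: ifP => // _; rewrite scale0r.
Qed.

End CharacterSums.

(** Partition [X] by the letter [u 0 k]: the fibre over [a] has [ncoord a X u] elements, each
    contributing [f a]. *)
Lemma prod_exp_ncoord (A : comPzRingType) (F : finFieldType) (n : nat)
    (f : F -> A) (X : {set 'I_n}) (u : 'rV[F]_n) :
  \prod_(a : F) f a ^+ ncoord a X u = \prod_(k in X) f (u 0 k).
Proof.
rewrite (partition_big (fun k => u 0 k) xpredT) //=; apply: eq_bigr => a _.
rewrite -prodr_const big_mkcond [RHS]big_mkcond /=.
by apply: eq_bigr => k _; rewrite inE; case: ifP => // /andP[_ /eqP->].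
Qed.

Section SplitProduct.
Variables (n l : nat) (X T : 'I_l -> {set 'I_n}) (c : 'I_n -> 'I_l).
Hypothesis X_disjoint : forall i j : 'I_l, i != j -> [disjoint X i & X j].
Hypothesis X_cover : \bigcup_(i < l) X i = [set: 'I_n].
Hypothesis T_sub : forall i : 'I_l, T i \subset X i.
Hypothesis c_block : forall k, k \in X (c k).

Lemma prod_split_coord (A : comPzRingType) (F : finFieldType)
    (fx fy : 'I_l -> F -> A) (u : 'rV[F]_n) :
  \prod_(i < l) \prod_(a : F)
     (fx i a ^+ ncoord a (T i) u * fy i a ^+ ncoord a (X i :\: T i) u) =
  \prod_(k < n) (if k \in T (c k) then fx else fy) (c k) (u 0 k).
Proof.
rewrite [RHS](eq_bigl (fun k => k \in [set: 'I_n])); last by move=> k; rewrite inE.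
rewrite -X_cover partition_disjoint_bigcup //; apply: eq_bigr => i _.
(* Blocks are disjoint and [k] already lies in [X (c k)]. *)
have c_unique k : k \in X i -> c k = i.
  by move=> ki; apply/eqP; apply: contraTT ki => /X_disjoint/disjointFr->.
rewrite big_split /= !prod_exp_ncoord [RHS](big_setID (T i)) /=.
rewrite (setIidPr (T_sub i)); congr (_ * _); apply: eq_bigr => k.
  by move=> kT; rewrite c_unique ?kT // (subsetP (T_sub i)).
by rewrite inE => /andP[/negPf kT kX]; rewrite c_unique ?kT.
Qed.

End SplitProduct.

Section Substitution.
Variables (R : realType) (F : finFieldType) (n l : nat).
Variables fx fy : 'I_l -> F -> jpoly R F l.

Lemma jsubst_xvar i a : jsubst (xvar R i a) fx fy = fx i a.
Proof. by rewrite /jsubst comp_mpolyXU -tnth_nth tnth_mktuple enum_rankK. Qed.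

Lemma jsubst_yvar i a : jsubst (yvar R i a) fx fy = fy i a.
Proof. by rewrite /jsubst comp_mpolyXU -tnth_nth tnth_mktuple enum_rankK. Qed.

(** Substitution is a ring morphism, so it passes through to the individual variables. *)
Lemma jsubst_SCJ (C : {vspace 'rV[F]_n}) (X T : 'I_l -> {set 'I_n}) :
  jsubst (SCJ R C X T) fx fy =
  \sum_(u in C) \prod_(i < l) \prod_(a : F)
     (fx i a ^+ ncoord a (T i) u * fy i a ^+ ncoord a (X i :\: T i) u).
Proof.
rewrite /SCJ /jsubst rmorph_sum; apply: eq_bigr => u _.
rewrite rmorph_prod; apply: eq_bigr => i _.
rewrite rmorph_prod; apply: eq_bigr => a _.
rewrite rmorphM !rmorphXn /=.
by rewrite -[_ \mPo _]/(jsubst _ fx fy) jsubst_xvar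
  -[_ \mPo _]/(jsubst _ fx fy) jsubst_yvar.
Qed.

End Substitution.

Theorem theorem4p1 (R : realType) (F : finFieldType) (n l : nat)
    (C : {vspace 'rV[F]_n}) (X T : 'I_l -> {set 'I_n}) (chi : F -> R[i])
    (X_disjoint : forall i j : 'I_l, i != j -> [disjoint X i & X j])
    (X_cover : \bigcup_(i < l) X i = [set: 'I_n])
    (T_sub : forall i : 'I_l, T i \subset X i)
    (chi_nontriv : nontrivial_character chi) :
  SCJ R (dual_code C) X T =
  (#|C|%:R : R[i])^-1 *:
    jsubst (SCJ R C X T)
      (fun i a => \sum_(b : F) chi (a * b) *: xvar R i b)
      (fun i a => \sum_(b : F) chi (a * b) *: yvar R i b).
Proof.
have [[chi_neq0 chiD] chi_neq1] := chi_nontriv.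
(* [chi 0] is idempotent and nonzero. *)
have chi0 : chi 0 = 1.
  by apply: (mulfI (chi_neq0 0)); rewrite -chiD addr0 mulr1.
have cardC : (#|C|%:R : R[i]) != 0.
  by rewrite pnatr_eq0 -lt0n; apply/card_gt0P; exists 0; rewrite mem0v.
have [c c_block] : exists c : 'I_n -> 'I_l, forall k, k \in X (c k).
  apply: (fin_all_exists (P := fun k i => k \in X i)) => k.
  have /bigcupP[i _ ki] : k \in \bigcup_(i < l) X i by rewrite X_cover inE.
  by exists i.
pose g k := (if k \in T (c k) then @xvar R F l else @yvar R F l) (c k).
(* Kept general in [fx] and [fy] to serve twice: with the bare variables for the dual code, and with
   the substituted sums for [C]. *)
have splitE fx fy (u : 'rV[F]_n) :=
  @prod_split_coord _ _ _ _ c X_disjoint X_cover T_sub c_block (jpoly R F l) _ fx fy u.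
have dualE : SCJ R (dual_code C) X T =
    \sum_(v in dual_code C) \prod_(k < n) g k (v 0 k).
  by apply: eq_bigr => v _; exact: splitE.
rewrite dualE jsubst_SCJ; apply: (canRL (scalerK cardC)).
rewrite -(poisson_summation_code chiD chi0 chi_neq1); apply: eq_bigr => u _.
rewrite splitE; apply: eq_bigr => k _.
(* The [x] and [y] variables undergo the same transform, so the choice between them commutes with
   the sum over [b]. *)
by rewrite /g; case: ifP.
Qed.
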